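(* ADOM+ with multi-consensus (described in the context) requires $$\mathcal O\left(\sqrt{L/\mu}\,\log\frac1\epsilon\right)\ \text{local computation rounds and}\quad \mathcal O\left(\chi\sqrt{L/\mu}\,\log\frac1\epsilon\right)\ \text{decentralized communication rounds}$$ to find an $\epsilon$-accurate solution of the distributed optimization problem $\min_{x\in\mathbb R^d}\sum_{i=1}^nf_i(x)$.
   Context: **Problem.** $\mathcal V=\{1,\dots,n\}$; $f_i:\mathbb R^d\to\mathbb R$, stored at node $i$, are $L$-smooth and $\mu$-strongly convex, $0<\mu\le L$, i.e. $f_i(y)+\langle\nabla f_i(y),x-y\rangle+\frac\mu2\|x-y\|^2\le f_i(x)\le f_i(y)+\langle\nabla f_i(y),x-y\rangle+\frac L2\|x-y\|^2$ for all $x,y\in\mathbb R^d$. $F:(\mathbb R^d)^{\mathcal V}\to\mathbb R$, $F(x)=\sum_if_i(x_i)$; $\mathcal L=\{x\in(\mathbb R^d)^{\mathcal V}:x_1=\dots=x_n\}$; $\mathcal L^\perp=\{z\in(\mathbb R^d)^{\mathcal V}:\sum_iz_i=0\}$. $x^*\in\mathcal L$ is the unique solution of $\min_{x\in\mathcal L}F(x)$ (all components equal the minimizer of $\sum_if_i$). **Gossip matrices.** For communication rounds $q=0,1,2,\dots$ there are graphs $\mathcal G^q=(\mathcal V,\mathcal E^q)$, $\mathcal E^q\subset\{(i,j):i\ne j\}$, and matrices $\mathbf W(q)\in\mathbb R^{n\times n}$ with: $\mathbf W(q)_{i,j}\ne0$ iff $(i,j)\in\mathcal E^q$ or $i=j$;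 $\ker\mathbf W(q)\supset\{x\in\mathbb R^n:x_1=\dots=x_n\}$; $\mathrm{range}\,\mathbf W(q)\subset\{x\in\mathbb R^n:\sum_ix_i=0\}$; and there is $\chi\ge1$, common to all $q$, with $\|\mathbf W(q)x-x\|^2\le(1-\chi^{-1})\|x\|^2$ whenever $\sum_ix_i=0$. **Multi-consensus matrix.** With $T=\lceil\chi\ln2\rceil$, $\mathbf W(k;T)=\mathbf I-\prod_{q=kT}^{(k+1)T-1}(\mathbf I-\mathbf W(q))$ (factors with larger $q$ acting later). Multiplying by $\mathbf W(k;T)\otimes\mathbf I_d$ uses $T$ communication rounds, with indices $kT,\dots,kT+T-1$ (several stacked vectors may be transmitted in the same round). **ADOM+ with multi-consensus.** Input $x^0,y^0,m^0\in(\mathbb R^d)^{\mathcal V}$, $z^0\in\mathcal L^\perp$; $x_f^0=x^0$, $y_f^0=y^0$, $z_f^0=z^0$. For $k=0,1,2,\dots$ (the equations for $x^{k+1},y^{k+1}$ are solved jointly): - $x_g^k=\tau_1x^k+(1-\tau_1)x_f^k$ - $x^{k+1}=x^k+\eta\alpha(x_g^k-x^{k+1})-\eta[\nabla F(x_g^k)-\nu x_g^k-y^{k+1}]$ - $x_f^{k+1}=x_g^k+\tau_2(x^{k+1}-x^k)$ - $y_g^k=\sigma_1y^k+(1-\sigma_1)y_f^k$ - $y^{k+1}=y^k+\theta\beta(\nabla F(x_g^k)-\nu x_g^k-y^{k+1})-\theta[\nu^{-1}(y_g^k+z_g^k)+x^{k+1}]$ - $y_f^{k+1}=y_g^k+\sigma_2(y^{k+1}-y^k)$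 - $z_g^k=\sigma_1z^k+(1-\sigma_1)z_f^k$ - $z^{k+1}=z^k+\gamma\delta(z_g^k-z^k)-(\mathbf W(k;T)\otimes\mathbf I_d)[\gamma\nu^{-1}(y_g^k+z_g^k)+m^k]$ - $m^{k+1}=\gamma\nu^{-1}(y_g^k+z_g^k)+m^k-(\mathbf W(k;T)\otimes\mathbf I_d)[\gamma\nu^{-1}(y_g^k+z_g^k)+m^k]$ - $z_f^{k+1}=z_g^k-\zeta(\mathbf W(k;T)\otimes\mathbf I_d)(y_g^k+z_g^k)$ Each iteration uses one evaluation of $\nabla F$, i.e. $\mathcal O(1)$ local computation rounds (a local computation round: each node $i$ evaluates $\nabla f_i$ and forms linear combinations of its local vectors). **Parameters.** With $\hat\chi=2$: $\tau_2=\sqrt{\mu/L}$, $\tau_1=(1/\tau_2+1/2)^{-1}$, $\eta=(L\tau_2)^{-1}$, $\alpha=\nu=\mu/2$, $\beta=1/(2L)$, $\sigma_2=\frac{\sqrt\mu}{16\hat\chi\sqrt L}$, $\sigma_1=(1/\sigma_2+1/2)^{-1}$, $\theta=\frac{\nu}{4\sigma_2}$, $\gamma=\frac{\nu}{14\sigma_2\hat\chi^2}$, $\delta=\frac1{17L}$, $\zeta=\frac12$. **Accuracy and asymptotic notation.** $x^k$ is $\epsilon$-accurate if $\|x^k-x^*\|^2\le\epsilon$. $\mathcal O(\cdot)$ hides a universal constant, for $\epsilon>0$ below a threshold that may depend on the problem and the initial point. *)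

(* Defs.v *)
From HB Require Import structures.
From mathcomp Require Import all_boot all_order all_algebra.
From mathcomp Require Import all_classical all_reals all_analysis.

Set Implicit Arguments.
Unset Strict Implicit.
Unset Printing Implicit Defensive.

Import Order.TTheory GRing.Theory Num.Theory.
Import numFieldNormedType.Exports.

Local Open Scope ring_scope.

(* A point of (R^d)^V, V = 'I_n, is a matrix X : 'M[R]_(n, d) whose i-th row  *)
(* is the vector held by node i.  The operator W (x) I_d then acts by         *)
(* X |-> W *m X.                                                              *)

(* Euclidean structure; the library norm `|X| on matrices is the sup norm.    *)
Definition inner (R : realType) (m n : nat) (X Y : 'M[R]_(m, n)) : R :=
  \sum_i \sum_j X i j * Y i j.

Definition sqnorm (R : realType) (m n : nat) (X : 'M[R]_(m, n)) : R :=
  inner X X.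

Definition grad (R : realType) (d : nat) (f : 'rV[R]_d -> R) (x : 'rV[R]_d)
    : 'rV[R]_d :=
  \row_j 'D_(delta_mx 0 j) f x.

Definition strongly_convex (R : realType) (d : nat) (mu : R)
    (f : 'rV[R]_d -> R) : Prop :=
  forall x y, f y + inner (grad f y) (x - y) + mu / 2 * sqnorm (x - y) <= f x.

Definition smooth (R : realType) (d : nat) (L : R) (f : 'rV[R]_d -> R) : Prop :=
  forall x y, f x <= f y + inner (grad f y) (x - y) + L / 2 * sqnorm (x - y).

Definition consensus (R : realType) (n d : nat) (X : 'M[R]_(n, d)) : Prop :=
  forall i j, row i X = row j X.

Definition zero_sum (R : realType) (n d : nat) (X : 'M[R]_(n, d)) : Prop :=
  \sum_i row i X = 0.

Definition objective (R : realType) (n d : nat) (f : 'I_n -> 'rV[R]_d -> R)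
    (X : 'M[R]_(n, d)) : R :=
  \sum_i f i (row i X).

Definition grad_objective (R : realType) (n d : nat)
    (f : 'I_n -> 'rV[R]_d -> R) (X : 'M[R]_(n, d)) : 'M[R]_(n, d) :=
  \matrix_i grad (f i) (row i X).

Definition is_solution (R : realType) (n d : nat) (f : 'I_n -> 'rV[R]_d -> R)
    (xs : 'M[R]_(n, d)) : Prop :=
  consensus xs /\ forall X, consensus X -> objective f xs <= objective f X.

Record gossip_sequence (R : realType) (n : nat) (chi : R)
    (E : nat -> rel 'I_n) (W : nat -> 'M[R]_n) : Prop := GossipSequence {
  gossip_loopless : forall q, irreflexive (E q);
  gossip_support : forall q i j, (W q i j != 0) = E q i j || (i == j);
  gossip_kernel : forall q (x : 'cV[R]_n), consensus x -> W q *m x = 0;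
  gossip_range : forall q (x : 'cV[R]_n), zero_sum (W q *m x);
  gossip_contraction : forall q (x : 'cV[R]_n), zero_sum x ->
    sqnorm (W q *m x - x) <= (1 - chi^-1) * sqnorm x }.

Definition consensus_length (R : realType) (chi : R) : nat :=
  `|Num.ceil (chi * ln 2)|%N.

(* Reversed range: the factor with the largest q is leftmost, so acts last.   *)
Definition multi_consensus (R : realType) (n : nat) (W : nat -> 'M[R]_n)
    (T k : nat) : 'M[R]_n :=
  1%:M - \big[mulmx/1%:M]_(q <- rev (index_iota (k * T) (k.+1 * T)))
           (1%:M - W q).

Record coefficients (R : realType) := Coefficients {
  tau1 : R; tau2 : R; eta : R; alpha : R; nu : R; beta : R;
  sigma1 : R; sigma2 : R; theta : R; gamma : R; delta : R; zeta : R }.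

Definition adom_coefficients (R : realType) (chi_hat L mu : R) : coefficients R :=
  let t2 := Num.sqrt (mu / L) in
  let v := mu / 2 in
  let s2 := Num.sqrt mu / (16 * chi_hat * Num.sqrt L) in
  {| tau1 := (t2^-1 + 2^-1)^-1;
     tau2 := t2;
     eta := (L * t2)^-1;
     alpha := mu / 2;
     nu := v;
     beta := (2 * L)^-1;
     sigma1 := (s2^-1 + 2^-1)^-1;
     sigma2 := s2;
     theta := v / (4 * s2);
     gamma := v / (14 * s2 * chi_hat ^+ 2);
     delta := (17 * L)^-1;
     zeta := 2^-1 |}.

(* The counters record the rounds spent since the start of the run.           *)
Record state (R : realType) (n d : nat) := State {
  sx : 'M[R]_(n, d); sxf : 'M[R]_(n, d);
  sy : 'M[R]_(n, d); syf : 'M[R]_(n, d);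
  sz : 'M[R]_(n, d); szf : 'M[R]_(n, d);
  sm : 'M[R]_(n, d);
  local_rounds : nat; comm_rounds : nat }.

Definition initial_state (R : realType) (n d : nat)
    (x0 y0 z0 m0 : 'M[R]_(n, d)) : state R n d :=
  {| sx := x0; sxf := x0; sy := y0; syf := y0; sz := z0; szf := z0; sm := m0;
     local_rounds := 0; comm_rounds := 0 |}.

(* One iteration with gradient oracle G and multi-consensus matrix Wk.  It is *)
(* a relation because the updates of x and y are implicit in (x, y).  It      *)
(* evaluates G at the single point xg, and its three products with Wk share   *)
(* the same T communication rounds.                                           *)
Definition adom_step (R : realType) (n d : nat) (p : coefficients R)
    (G : 'M[R]_(n, d) -> 'M[R]_(n, d)) (T : nat) (Wk : 'M[R]_n)
    (s s' : state R n d) : Prop :=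
  let xg := tau1 p *: sx s + (1 - tau1 p) *: sxf s in
  let yg := sigma1 p *: sy s + (1 - sigma1 p) *: syf s in
  let zg := sigma1 p *: sz s + (1 - sigma1 p) *: szf s in
  let u := (gamma p * (nu p)^-1) *: (yg + zg) + sm s in
  (sx s' = sx s + (eta p * alpha p) *: (xg - sx s')
             - eta p *: (G xg - nu p *: xg - sy s')) /\
  (sxf s' = xg + tau2 p *: (sx s' - sx s)) /\
  (sy s' = sy s + (theta p * beta p) *: (G xg - nu p *: xg - sy s')
             - theta p *: ((nu p)^-1 *: (yg + zg) + sx s')) /\
  (syf s' = yg + sigma2 p *: (sy s' - sy s)) /\
  (sz s' = sz s + (gamma p * delta p) *: (zg - sz s) - Wk *m u) /\
  (sm s' = u - Wk *m u) /\
  (szf s' = zg - zeta p *: (Wk *m (yg + zg))) /\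
  local_rounds s' = (local_rounds s + 1)%N /\
  comm_rounds s' = (comm_rounds s + T)%N.

Definition adom_run (R : realType) (n d : nat) (p : coefficients R)
    (G : 'M[R]_(n, d) -> 'M[R]_(n, d)) (W : nat -> 'M[R]_n) (T : nat)
    (x0 y0 z0 m0 : 'M[R]_(n, d)) (s : nat -> state R n d) : Prop :=
  s 0%N = initial_state x0 y0 z0 m0 /\
  forall k, adom_step p G T (multi_consensus W T k) (s k) (s k.+1).

Definition accurate (R : realType) (n d : nat) (eps : R)
    (xs X : 'M[R]_(n, d)) : Prop :=
  sqnorm (X - xs) <= eps.

(* Main.v *)
Require Import Defs.
From HB Require Import structures.
From mathcomp Require Import all_boot all_order all_algebra.
From mathcomp Require Import all_classical all_reals all_analysis.
From mathcomp Require Import ring lra.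

(* Idea: put t = sqrt (mu / L) and shift all variables by the saddle point
   (xs, ys, zs) = (xs, G xs - nu xs, - G xs), G being the gradient of the
   objective.  With H(x) = F(x) - nu/2 |x|^2 and D its Bregman divergence to
   xs, the accelerated primal step gives
     (1/eta + alpha) |x'|^2 + 2/tau2 D(xf') + D(xg)
       <= |x|^2/eta + (2/tau2 - 1) D(xf) + 2 <x', y'>,
   while the dual steps contract a quadratic form up to D(xg) - 2 <x', y'>, so
   the sum is a Lyapunov function decaying by 1 - t/64 per iteration.  The
   error-feedback memory m is absorbed by tracking z - P m instead of z, where
   P is the projection onto zero-sum vectors: the increment of z - P m no longer
   involves the gossip matrix. *)

Set Implicit Arguments.
Unset Strict Implicit.
Unset Printing Implicit Defensive.

Import Order.TTheory GRing.Theory Num.Theory.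
Import numFieldNormedType.Exports.

Local Open Scope ring_scope.

(** * Euclidean algebra of matrices *)

Section InnerProduct.
Context {R : realType} {m n : nat}.
Implicit Types (a : R) (X Y Z : 'M[R]_(m, n)).

Lemma innerC X Y : inner X Y = inner Y X.
Proof. by apply: eq_bigr => i _; apply: eq_bigr => j _; rewrite mulrC. Qed.

Lemma innerDl X Y Z : inner (X + Y) Z = inner X Z + inner Y Z.
Proof.
rewrite /inner -big_split; apply: eq_bigr => i _ /=.
by rewrite -big_split; apply: eq_bigr => j _; rewrite mxE mulrDl.
Qed.

Lemma innerZl a X Y : inner (a *: X) Y = a * inner X Y.
Proof.
rewrite /inner mulr_sumr; apply: eq_bigr => i _; rewrite mulr_sumr.
by apply: eq_bigr => j _; rewrite mxE mulrA.
Qed.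

Lemma innerDr X Y Z : inner X (Y + Z) = inner X Y + inner X Z.
Proof. by rewrite innerC innerDl !(innerC X). Qed.

Lemma innerZr a X Y : inner X (a *: Y) = a * inner X Y.
Proof. by rewrite innerC innerZl (innerC X). Qed.

Lemma innerNl X Y : inner (- X) Y = - inner X Y.
Proof. by rewrite -scaleN1r innerZl mulN1r. Qed.

Lemma innerNr X Y : inner X (- Y) = - inner X Y.
Proof. by rewrite innerC innerNl innerC. Qed.

Lemma inner0l X : inner 0 X = 0.
Proof. by rewrite -(scale0r 0) innerZl mul0r. Qed.

Definition innerE :=
  (innerDl, innerDr, innerNl, innerNr, innerZl, innerZr).

Lemma sqnorm_ge0 X : 0 <= sqnorm X.
Proof. by rewrite !sumr_ge0// => i _; rewrite sumr_ge0// => j _; exact: sqr_ge0. Qed.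

Lemma inner_rows X Y : inner X Y = \sum_i inner (row i X) (row i Y).
Proof.
apply: eq_bigr => i _; rewrite /inner big_ord1.
by apply: eq_bigr => j _; rewrite !mxE.
Qed.

Lemma sqnorm_cols X : sqnorm X = \sum_j sqnorm (col j X).
Proof.
rewrite /sqnorm /inner exchange_big; apply: eq_bigr => j _ /=.
by apply: eq_bigr => i _; rewrite big_ord1 !mxE.
Qed.

(** Young's inequality: the gap between the two sides is the square [a^-1 * sqnorm (a *: X - Y)]. *)
Lemma sqnormD_le a X Y : 0 < a ->
  sqnorm (X + Y) <= (1 + a) * sqnorm X + (1 + a^-1) * sqnorm Y.
Proof.
move=> a0; rewrite -subr_ge0.
have -> : (1 + a) * sqnorm X + (1 + a^-1) * sqnorm Y - sqnorm (X + Y) =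
    a^-1 * sqnorm (a *: X - Y).
  rewrite /sqnorm !innerE (innerC Y X); field; lra.
by rewrite mulr_ge0 ?sqnorm_ge0// invr_ge0 ltW.
Qed.

End InnerProduct.

(** * Entrywise descriptions of the consensus and zero-sum subspaces *)

Section Consensus.
Context {R : realType} {n d : nat}.
Implicit Types (X Y Z : 'M[R]_(n, d)).

Lemma zero_sumP X : zero_sum X <-> forall j, \sum_i X i j = 0.
Proof.
rewrite /zero_sum; split=> [X0 j|X0].
  transitivity ((\sum_i row i X) 0 j); last by rewrite X0 mxE.
  by rewrite summxE; apply: eq_bigr => i _; rewrite mxE.
apply/rowP => j; rewrite summxE [RHS]mxE -[RHS](X0 j).
by apply: eq_bigr => i _; rewrite mxE.
Qed.

Lemma consensusP X : consensus X <-> forall i k j, X i j = X k j.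
Proof.
split=> [cX i k j|cX i k]; last by apply/rowP => j; rewrite !mxE.
by have := congr1 (fun v : 'rV_d => v 0 j) (cX i k); rewrite /= !mxE.
Qed.

End Consensus.

(** * Orthogonal decomposition into consensus and zero-sum parts *)

Section Centering.
Context {R : realType} {n d : nat}.
Implicit Types (X Y Z : 'M[R]_(n, d)).

Lemma consensus_col X j : consensus X -> consensus (col j X).
Proof. by move=> /consensusP cX i k; apply/rowP => l; rewrite !mxE. Qed.

Lemma zero_sum_col X : zero_sum X <-> forall j, zero_sum (col j X).
Proof.
rewrite zero_sumP; split=> X0 j.
  by apply/zero_sumP => k; rewrite -[RHS](X0 j); apply: eq_bigr => i _; rewrite mxE.
have /zero_sumP X0j := X0 j.
by rewrite -[RHS](X0j 0); apply: eq_bigr => i _; rewrite mxE.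
Qed.

Lemma zero_sumD X Y : zero_sum X -> zero_sum Y -> zero_sum (X + Y).
Proof.
rewrite /zero_sum => X0 Y0; under eq_bigr do rewrite linearD.
by rewrite big_split /= X0 Y0 addr0.
Qed.

Lemma zero_sumZ a X : zero_sum X -> zero_sum (a *: X).
Proof.
rewrite /zero_sum => X0; under eq_bigr do rewrite linearZ.
by rewrite -scaler_sumr X0 scaler0.
Qed.

Lemma zero_sumN X : zero_sum X -> zero_sum (- X).
Proof. by rewrite -scaleN1r; exact: zero_sumZ. Qed.

Lemma inner_consensus_zero_sum X Y : consensus X -> zero_sum Y -> inner X Y = 0.
Proof.
move=> /consensusP cX /zero_sumP Y0; rewrite /inner exchange_big big1//= => j _.
(* Factoring out the common row needs a reference index, which exists only for [n > 0]. *)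
case: n X Y cX Y0 => [|n'] X Y cX Y0; first by rewrite big_ord0.
under eq_bigr do rewrite (cX _ ord0).
by rewrite -mulr_sumr Y0 mulr0.
Qed.

(** The orthogonal projection [P] onto zero-sum matrices: subtraction of the mean row. *)
Definition centering X : 'M[R]_(n, d) :=
  X - (n%:R^-1 *: const_mx 1 : 'M[R]_n) *m X.

Lemma centeringD X Y : centering (X + Y) = centering X + centering Y.
Proof. by rewrite /centering mulmxDr opprD addrACA. Qed.

Lemma centeringZ a X : centering (a *: X) = a *: centering X.
Proof. by rewrite /centering -scalemxAr scalerBr. Qed.

Lemma averageE X i j :
  ((n%:R^-1 *: const_mx 1 : 'M[R]_n) *m X) i j = n%:R^-1 * \sum_k X k j.
Proof. by rewrite mxE mulr_sumr; apply: eq_bigr => k _; rewrite !mxE mulr1. Qed.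

Lemma consensus_subr_centering X : consensus (X - centering X).
Proof.
by apply/consensusP => i k j; rewrite /centering opprB addrC subrK !averageE.
Qed.

Lemma zero_sum_centering X : zero_sum (centering X).
Proof.
apply/zero_sumP => j.
under eq_bigr do rewrite 2!mxE averageE.
rewrite sumrB sumr_const card_ord -[X in _ - X]mulr_natr.
have [n0|n0] := eqVneq (n%:R : R) 0; last by field.
(* A null [n%:R] means [n = 0], so there is no index [i] to check. *)
rewrite n0 mulr0 subr0 big1// => i; have := leq_ltn_trans (leq0n _) (ltn_ord i).
by rewrite lt0n -(@pnatr_eq0 R) n0 eqxx.
Qed.

Lemma centering_id X : zero_sum X -> centering X = X.
Proof.
move=> /zero_sumP X0; apply/matrixP => i j.
by rewrite 2!mxE averageE X0 mulr0 subr0.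
Qed.

Lemma centering_consensus X : consensus X -> centering X = 0.
Proof.
move=> /consensusP cX; apply/matrixP => i j.
rewrite 2!mxE averageE [RHS]mxE; under eq_bigr do rewrite (cX _ i).
rewrite sumr_const card_ord -[X in _ * X]mulr_natr mulrC mulfK ?subrr//.
by rewrite pnatr_eq0 -lt0n; apply: leq_ltn_trans (ltn_ord i).
Qed.

(** [X - centering X] is a consensus matrix, hence orthogonal to [Z]. *)
Lemma inner_centering X Z : zero_sum Z -> inner Z (centering X) = inner Z X.
Proof.
move=> Z0; apply/eqP; rewrite eq_sym -subr_eq0 -innerNr -innerDr innerC.
by apply/eqP/inner_consensus_zero_sum => //; exact: consensus_subr_centering.
Qed.

End Centering.

(** What the analysis retains of a gossip matrix. Quantifying over [d] makes it a statement about
    [W (x) I_d] for every [d], and the free constant [c] lets products be covered as well. *)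
Record averaging (R : realType) (n : nat) (c : R) (W : 'M[R]_n) : Prop := Averaging {
  averaging_kernel : forall d (X : 'M[R]_(n, d)), consensus X -> W *m X = 0;
  averaging_range : forall d (X : 'M[R]_(n, d)), zero_sum (W *m X);
  averaging_contraction : forall d (X : 'M[R]_(n, d)), zero_sum X ->
    sqnorm (X - W *m X) <= c * sqnorm X }.

(** * Contraction by gossip matrices and by their products *)

Section Gossip.
Context {R : realType} {n : nat}.
Implicit Types (c chi : R) (W : 'M[R]_n).

Lemma col_mulmx d (A : 'M[R]_n) (X : 'M[R]_(n, d)) j :
  col j (A *m X) = A *m col j X.
Proof.
by apply/colP => i; rewrite !mxE; apply: eq_bigr => k _; rewrite mxE.
Qed.

(** The gossip axioms concern single column vectors; they extend column by column because squared
    norms add up over columns. *)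
Lemma gossip_averaging chi E (W : nat -> 'M[R]_n) q :
  gossip_sequence chi E W -> averaging (1 - chi^-1) (W q).
Proof.
move=> [_ _ Wker Wrange Wcontr]; split=> d X.
- move=> cX; apply/matrixP => i j; rewrite [RHS]mxE.
  have := congr1 (fun v : 'cV_n => v i 0) (Wker q _ (consensus_col j cX)).
  by rewrite -col_mulmx mxE [RHS]mxE.
- by apply/zero_sum_col => j; rewrite col_mulmx.
- move=> /zero_sum_col X0; rewrite 2!sqnorm_cols mulr_sumr ler_sum// => j _.
  rewrite linearB /= col_mulmx -opprB /sqnorm innerNl innerNr opprK.
  exact: Wcontr.
Qed.

(** The error operators [1 - W q] preserve zero-sum matrices, so their contraction factors
    multiply. *)
Lemma averaging_prod c (W : nat -> 'M[R]_n) (r : seq nat) : 0 <= c ->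
  (forall q, averaging c (W q)) ->
  averaging (c ^+ size r)
    (1%:M - \big[mulmx/1%:M]_(q <- r) (1%:M - W q)).
Proof.
move=> c0 cW; elim: r => [|q r IH].
  rewrite big_nil subrr; split=> d X.
  - by rewrite mul0mx.
  - by rewrite mul0mx; apply/zero_sumP => j; rewrite big1// => i _; rewrite mxE.
  - by rewrite mul0mx subr0 expr0 mul1r.
(* The head factor acts last, on the residual [X - Y] left by the tail. *)
have WE d (X : 'M[R]_(n, d)) :
  (1%:M - \big[mulmx/1%:M]_(p <- q :: r) (1%:M - W p)) *m X =
  let Y := (1%:M - \big[mulmx/1%:M]_(p <- r) (1%:M - W p)) *m X in
  Y + W q *m (X - Y).
  by rewrite /= big_cons !mulmxBl !mul1mx -!mulmxA subKr opprB addrA addrAC.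
split=> d X.
- move=> cX; rewrite WE/= (averaging_kernel IH cX) add0r subr0.
  exact: (averaging_kernel (cW q)).
- by rewrite WE/=; apply: zero_sumD; [exact: (averaging_range IH)
    |exact: (averaging_range (cW q))].
- move=> X0; rewrite WE/=; set Y := _ *m X.
  have Y0 : zero_sum Y by exact: (averaging_range IH).
  rewrite opprD addrA exprS -mulrA.
  apply: le_trans (averaging_contraction (cW q) _) _.
    by apply: zero_sumD => //; exact: zero_sumN.
  by rewrite ler_wpM2l// (averaging_contraction IH).
Qed.

Lemma averaging_le c c' W : c <= c' -> averaging c W -> averaging c' W.
Proof.
move=> cc' [Wker Wrange Wcontr]; split=> // d X X0.
by apply: le_trans (Wcontr _ _ X0) _; rewrite ler_wpM2r ?sqnorm_ge0.
Qed.

Lemma ge0_ceil_natr (x : R) : 0 <= x -> (`|Num.ceil x|%N)%:R = (Num.ceil x)%:~R :> R.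
Proof.
move=> x0; rewrite -[in RHS](@gez0_abs (Num.ceil x))//.
by rewrite -(ler_int R) (le_trans x0)// ceil_ge.
Qed.

(* [(1 - 1/chi)^T <= exp (- T / chi) <= exp (- ln 2)]. *)
Lemma multi_consensus_averaging chi E (W : nat -> 'M[R]_n) k : 1 <= chi ->
  gossip_sequence chi E W ->
  averaging 2^-1 (multi_consensus W (consensus_length chi) k).
Proof.
move=> chi1 gW; set T := consensus_length chi.
have chi0 : 0 < chi by lra.
have ln20 : 0 <= ln 2 :> R by rewrite ln_ge0// ler1n.
have c0 : 0 <= 1 - chi^-1 by rewrite subr_ge0 invf_le1.
have := averaging_prod (rev (index_iota (k * T) (k.+1 * T))) c0
  (fun q => gossip_averaging q gW).
apply: averaging_le.
rewrite size_rev size_iota mulSn addnK.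
have TE : chi * ln 2 <= T%:R.
  by rewrite ge0_ceil_natr ?ceil_ge// mulr_ge0// ltW.
have : (1 - chi^-1) ^+ T <= expR (- chi^-1) ^+ T.
  by rewrite lerXn2r ?nnegrE ?expR_ge0//; apply: expR_ge1Dx.
move=> /le_trans; apply; rewrite -expRM_natl.
rewrite -[leRHS](@lnK R) ?posrE ?invr_gt0// ler_expR lnV ?posrE//.
rewrite mulrN lerN2 ler_pdivlMr// mulrC//.
Qed.

(** The ceiling is below [chi * ln 2 + 1], and [ln 2 <= 1 <= chi]. *)
Lemma consensus_length_le chi : 1 <= chi -> (consensus_length chi)%:R <= 2 * chi.
Proof.
move=> chi1.
have ln21 : ln 2 <= 1 :> R.
  rewrite -[leRHS]expRK ler_ln ?posrE ?expR_gt0//.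
  by apply: le_trans (expR_ge1Dx 1); lra.
have ln20 : 0 <= ln 2 :> R by rewrite ln_ge0// ler1n.
rewrite ge0_ceil_natr; last by rewrite mulr_ge0//; lra.
have /andP[+ _] := ceil_itv (chi * ln 2 : R).
nra.
Qed.

End Gossip.

(** * One-step inequalities, in variables shifted by the saddle point *)

Section Descent.
Context {R : realType} {m n : nat}.
Implicit Types (L t : R).

(** Here [h] is the gradient of the divergence at [xg]. The gap is a nonnegative combination of the
    smoothness bound at [xf'], convexity at [xf], strong convexity at the solution (the origin after
    the shift) and [sqnorm (xg - x')]. *)
Lemma primal_descent L t (x xf xg x' xf' h y' : 'M[R]_(m, n)) (Df Dg Df' : R) :
  0 < L -> 0 < t -> t <= 1 ->
  xg = (2 * t / (2 + t)) *: x + (1 - 2 * t / (2 + t)) *: xf ->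
  x' = x + ((L * t)^-1 * (L * t ^+ 2 / 2)) *: (xg - x')
         - (L * t)^-1 *: (h - y') ->
  xf' = xg + t *: (x' - x) ->
  Df' <= Dg + inner h (xf' - xg) + L / 2 * sqnorm (xf' - xg) ->
  Dg + inner h (xf - xg) <= Df ->
  Dg - inner h xg + L * t ^+ 2 / 4 * sqnorm xg <= 0 ->
  L * (t + t ^+ 2 / 2) * sqnorm x' + 2 / t * Df' + Dg <=
    L * t * sqnorm x + (2 / t - 1) * Df + 2 * inner x' y'.
Proof.
move=> L0 t0 t1 xgE x'E xf'E smoothH convH strongH.
(* Pairing the implicit update with [x'] isolates the coupling term [inner x' y']. *)
have {x'E} y'E : inner x' y' = (L * t) * (sqnorm x' - inner x x')
    - L * t ^+ 2 / 2 * (inner xg x' - sqnorm x') + inner h x'.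
  have := congr1 (inner x') x'E.
  rewrite !innerE /sqnorm (innerC x' x) (innerC x' h) (innerC x' xg) => E.
  apply/eqP; rewrite -subr_eq0; apply/eqP.
  transitivity (L * t * (inner x x'
      + (L * t)^-1 * (L * t ^+ 2 / 2) * (inner xg x' - inner x' x')
      - (L * t)^-1 * (inner h x' - inner x' y') - inner x' x')).
    by field; rewrite ?gt_eqF.
  by rewrite -E subrr mulr0.
have hxf : (2 - t) * inner h (xf - xg) = 2 * t * (inner h xg - inner h x).
  have := congr1 (inner h) xgE; rewrite !innerE => ->; field; lra.
have xf'xg : xf' - xg = t *: (x' - x) by rewrite xf'E addrC addKr.
move: smoothH; rewrite xf'xg => smoothH.
have := sqnorm_ge0 (xg - x').
rewrite -subr_ge0 => H4; rewrite -subr_ge0.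
rewrite -subr_ge0 in smoothH; rewrite -subr_ge0 in convH.
rewrite -subr_ge0 in strongH.
have -> : L * t * sqnorm x + (2 / t - 1) * Df + 2 * inner x' y'
   - (L * (t + t ^+ 2 / 2) * sqnorm x' + 2 / t * Df' + Dg) =
   2 / t * (Dg + inner h (t *: (x' - x)) + L / 2 * sqnorm (t *: (x' - x)) - Df')
   + (2 / t - 1) * (Df - (Dg + inner h (xf - xg)))
   + 2 * (0 - (Dg - inner h xg + L * t ^+ 2 / 4 * sqnorm xg))
   + L * t ^+ 2 / 2 * (sqnorm (xg - x') - 0).
  have -> : inner h (xf - xg) = 2 * t / (2 - t) * (inner h xg - inner h x).
    rewrite mulrAC -hxf; field; lra.
  rewrite y'E /sqnorm !innerE (innerC x' x) (innerC x' xg); field; lra.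
have r1 : 0 <= 2 / t - 1 by rewrite subr_ge0 ler_pdivlMr//; lra.
by rewrite !addr_ge0 ?mulr_ge0 ?invr_ge0 ?exprn_ge0//; lra.
Qed.

(* The dual inequalities are multiplied by [L * t ^+ 3] (by [t] only in
   [dual_average_step]) to clear the denominators of the step sizes. *)
Lemma dual_prox_step L t (x' y y' s h : 'M[R]_(m, n)) : 0 < L -> 0 < t ->
  y' = y + (4 * L * t * (2 * L)^-1) *: (h - y')
         - (4 * L * t) *: ((L * t ^+ 2 / 2)^-1 *: s + x') ->
  (t ^+ 2 / 4 + t ^+ 3 / 2) * sqnorm y' + t ^+ 2 / 4 * sqnorm (y' - y) <=
  t ^+ 2 / 4 * sqnorm y + t ^+ 3 / 2 * sqnorm h - 4 * t * inner s y'
    - 2 * L * t ^+ 3 * inner x' y'.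
Proof.
move=> L0 t0 y'E.
have {y'E} : 4 * L * t ^+ 3 * inner x' y' = t ^+ 2 * (inner y y' - sqnorm y')
    + 2 * t ^+ 3 * (inner h y' - sqnorm y') - 8 * t * inner s y'.
  have := congr1 (inner y') y'E.
  rewrite !innerE /sqnorm !(innerC y' y) !(innerC y' h) !(innerC y' s) !(innerC y' x').
  move=> /eqP; rewrite -subr_eq0 => /eqP E.
  apply/eqP; rewrite -subr_eq0; apply/eqP.
  transitivity (t ^+ 2 * 0); last by rewrite mulr0.
  by rewrite -E; field; rewrite ?gt_eqF.
have := mulr_ge0 (exprn_ge0 3 (ltW t0)) (sqnorm_ge0 (h - y')).
rewrite /sqnorm !innerE !(innerC y' y) !(innerC y' h); lra.
Qed.

(** [zh] is the multiplier corrected by the memory [p]. Polarization rewrites its product with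
    [zg - z], the parallelogram law bounds the squared increment, and [inner c z] can be exchanged
    for [inner s z]. *)
Lemma multiplier_step L t (z zg zh zh' p s c : 'M[R]_(m, n)) :
  0 < L -> 0 < t -> t <= 1 -> z = zh + p ->
  zh' = zh + (2 / 7 * L * t * (17 * L)^-1) *: (zg - z)
           - (2 / 7 * L * t * (L * t ^+ 2 / 2)^-1) *: c ->
  inner c z = inner s z ->
  7 / 2 * t ^+ 2 * sqnorm zh' <=
  (7 / 2 * t ^+ 2 - t ^+ 3 / 17) * sqnorm zh + t ^+ 3 / 17 * sqnorm (zg - p)
  - 4 * t * inner s z + 4 * t * inner c p + 16 / 7 * sqnorm c.
Proof.
move=> L0 t0 t1 zE zh'E <-.
(* The two scalars are [gamma * delta] and [gamma / nu]. *)
have {}zh'E : zh' = zh + ((2 * t / 119) *: (zg - z) - (4 / 7 / t) *: c).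
  rewrite zh'E addrA; congr (_ + _ *: _ - _ *: _); field; lra.
have -> : zg - p = (zg - z) + zh by rewrite zE opprD [- zh + _]addrC addrA subrK.
have -> : inner c p = inner c z - inner c zh by rewrite zE !innerE addrC addKr.
move: (zg - z) zh'E => e ->.
have := sqnorm_ge0 ((2 * t / 119) *: e + (4 / 7 / t) *: c).
move/(mulr_ge0 (exprn_ge0 2 (ltW t0))) => H1.
have H2 : 0 <= t ^+ 3 * (1 - t) * sqnorm e.
  by rewrite !mulr_ge0 ?exprn_ge0 ?sqnorm_ge0 ?subr_ge0// ltW.
have H3 : 0 <= t ^+ 3 * sqnorm e by rewrite mulr_ge0 ?exprn_ge0 ?sqnorm_ge0 ?ltW.
rewrite -subr_ge0.
set d := (X in 0 <= X).
have -> : d = 7 / 2 * (t ^+ 2 * sqnorm ((2 * t / 119) *: e + (4 / 7 / t) *: c))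
  + (1 / 17 - 4 * 7 / (119 ^+ 2)) * (t ^+ 3 * sqnorm e)
  + 4 * 7 / (119 ^+ 2) * (t ^+ 3 * (1 - t) * sqnorm e).
  rewrite /d /sqnorm !innerE !(innerC zh) !(innerC e c); field; lra.
lra.
Qed.

(** In the application [c] and [w] are [P s] and [W s]. The step length [1/2] makes the [sqnorm w]
    terms combine exactly with the contraction bound, which yields the gain [- 16 * sqnorm c]. *)
Lemma sum_step t (y y' q s sf sf' w c : 'M[R]_(m, n)) :
  0 < t -> t <= 1 ->
  s = (2 * t / (64 + t)) *: q + (1 - 2 * t / (64 + t)) *: sf ->
  sf' = s + (t / 32) *: (y' - y) - 2^-1 *: w ->
  inner c w = inner s w -> sqnorm (c - w) <= 2^-1 * sqnorm c ->
  64 * sqnorm sf' <= (64 - t) * sqnorm sf - 3 * t * sqnorm s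
    + t ^+ 2 / 8 * sqnorm (y' - y) - 16 * sqnorm c
    + 4 * t * (inner s (y' - y) + inner s q).
Proof.
move=> t0 t1 sE -> cw wc; move: (y' - y) => v.
have sq : 2 * t * inner s q = (64 + t) * sqnorm s - (64 - t) * inner s sf.
  have := congr1 (inner s) sE; rewrite !innerE /sqnorm => ->; field; lra.
have H1 : 0 <= (64 - t) * sqnorm (s - sf).
  by rewrite mulr_ge0 ?sqnorm_ge0//; lra.
have H2 := sqnorm_ge0 ((t / 32) *: v + 2^-1 *: w).
move: H1 H2 wc sq; rewrite /sqnorm !innerE -[inner w c]innerC cw.
rewrite !(innerC sf s) !(innerC v) !(innerC w); lra.
Qed.

(** Young's inequality with parameter 2, followed by the contraction factor [1/2], leaves the old
    memory with a factor [3/4 < 1]. *)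
Lemma residual_step L t (p p' c : 'M[R]_(m, n)) : 0 < L -> 0 < t ->
  sqnorm p' <= 2^-1 *
    sqnorm ((2 / 7 * L * t * (L * t ^+ 2 / 2)^-1) *: c + p) ->
  14 * t ^+ 2 * sqnorm p' <= 21 / 2 * t ^+ 2 * sqnorm p + 48 / 7 * sqnorm c.
Proof.
move=> L0 t0.
have -> : 2 / 7 * L * t * (L * t ^+ 2 / 2)^-1 = 4 / 7 / t by field; lra.
move=> p'u; have := sqnormD_le ((4 / 7 / t) *: c) p (_ : 0 < 2).
move=> /(_ ltac:(lra)) u.
have {}u := le_trans p'u (ler_wpM2l (_ : 0 <= 2^-1) u).
have {u} := ler_wpM2l (_ : 0 <= 14 * t ^+ 2) (u ltac:(lra)).
have t2 : 0 <= 14 * t ^+ 2 by rewrite mulr_ge0 ?exprn_ge0 ?ltW.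
move=> /(_ t2) /le_trans; apply.
rewrite /sqnorm !innerE le_eqVlt; apply/orP; left; apply/eqP; field; lra.
Qed.

(** [yf'] is a convex combination of [yf] and the extrapolated point
    [r = y' + (t / 64) *: (y' - y)]; convexity of the squared norm applies, then Young's inequality
    on [r]. *)
Lemma dual_average_step t (y y' yf yg yf' : 'M[R]_(m, n)) : 0 < t -> t <= 1 ->
  yg = (2 * t / (64 + t)) *: y + (1 - 2 * t / (64 + t)) *: yf ->
  yf' = yg + (t / 32) *: (y' - y) ->
  (32 + t / 2) * sqnorm yf' <= (32 - t / 2) * sqnorm yf
    + 17 / 16 * t * sqnorm y' + 17 / 4096 * t ^+ 3 * sqnorm (y' - y).
Proof.
move=> t0 t1 -> ->.
have := sqnormD_le y' ((t / 64) *: (y' - y)) (_ : 0 < 16^-1).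
move=> /(_ ltac:(lra)) /(ler_wpM2l (ltW t0)).
set r := y' + _ => rle.
have -> : (2 * t / (64 + t)) *: y + (1 - 2 * t / (64 + t)) *: yf + (t / 32) *: (y' - y)
  = (2 * t / (64 + t)) *: r + (1 - 2 * t / (64 + t)) *: yf.
  apply/matrixP => i j; rewrite /r !mxE; field; lra.
have -> : 17 / 4096 * t ^+ 3 * sqnorm (y' - y) =
  t * ((1 + 16^-1^-1) * sqnorm ((t / 64) *: (y' - y))).
  by rewrite /sqnorm !innerZl !innerZr; field.
have H : 0 <= t * (64 - t) / (64 + t) * sqnorm (r - yf).
  by rewrite !mulr_ge0 ?sqnorm_ge0 ?invr_ge0//; lra.
move: r rle H => r rle H.
suff : (32 + t / 2) * sqnorm ((2 * t / (64 + t)) *: r + (1 - 2 * t / (64 + t)) *: yf)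
   + t * (64 - t) / (64 + t) * sqnorm (r - yf)
  = t * sqnorm r + (32 - t / 2) * sqnorm yf.
  by move: H rle; lra.
by rewrite /sqnorm !innerE !(innerC yf r); field; lra.
Qed.

(** Sum of the preceding dual bounds. The products of [s] with [y'], [y] and [z] cancel, and the
    gain [- 16 * sqnorm c] of [sum_step] pays for [16/7], [48/7] and the [80/21] of the cross
    term. *)
Lemma dual_descent L t (Dg : R)
    (x' y y' yf yg yf' h z zf zg zh zh' p p' s sf sf' w c : 'M[R]_(m, n)) :
  0 < L -> 0 < t -> t <= 1 ->
  yg = (2 * t / (64 + t)) *: y + (1 - 2 * t / (64 + t)) *: yf ->
  y' = y + (4 * L * t * (2 * L)^-1) *: (h - y')
         - (4 * L * t) *: ((L * t ^+ 2 / 2)^-1 *: s + x') ->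
  yf' = yg + (t / 32) *: (y' - y) ->
  zg = (2 * t / (64 + t)) *: z + (1 - 2 * t / (64 + t)) *: zf ->
  z = zh + p ->
  zh' = zh + (2 / 7 * L * t * (17 * L)^-1) *: (zg - z)
           - (2 / 7 * L * t * (L * t ^+ 2 / 2)^-1) *: c ->
  s = yg + zg -> sf = yf + zf ->
  sf' = yf' + (zg - 2^-1 *: w) ->
  inner c z = inner s z -> inner c w = inner s w ->
  sqnorm (c - w) <= 2^-1 * sqnorm c ->
  sqnorm p' <= 2^-1 *
    sqnorm ((2 / 7 * L * t * (L * t ^+ 2 / 2)^-1) *: c + p) ->
  sqnorm h <= 2 * L * Dg ->
  (t ^+ 2 / 4 + t ^+ 3 / 32) * sqnorm y' + 64 / 5 * t ^+ 2 * sqnorm yf'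
  + 7 / 2 * t ^+ 2 * sqnorm zh' + 14 * t ^+ 2 * sqnorm p' + 64 * sqnorm sf'
  <= (1 - t / 64) *
    ((t ^+ 2 / 4 + t ^+ 3 / 32) * sqnorm y + 64 / 5 * t ^+ 2 * sqnorm yf
     + 7 / 2 * t ^+ 2 * sqnorm zh + 14 * t ^+ 2 * sqnorm p + 64 * sqnorm sf)
  + L * t ^+ 3 * Dg - 2 * L * t ^+ 3 * inner x' y'.
Proof.
move=> L0 t0 t1 ygE y'E yf'E zgE zE zh'E sE sfE sf'E cz cw wc p'u hD.
have HY := dual_prox_step L0 t0 y'E.
have HZ := multiplier_step L0 t0 t1 zE zh'E cz.
have HS : 64 * sqnorm sf' <= (64 - t) * sqnorm sf - 3 * t * sqnorm s
    + t ^+ 2 / 8 * sqnorm (y' - y) - 16 * sqnorm c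
    + 4 * t * (inner s (y' - y) + inner s (y + z)).
  apply: (sum_step t0 t1 _ _ cw wc).
    by rewrite sE ygE zgE sfE !scalerDr addrACA.
  by rewrite sf'E yf'E sE addrACA addrA.
have HP := residual_step L0 t0 p'u.
have HYF := dual_average_step t0 t1 ygE yf'E.
have Hcross : 4 * t * inner c p <= 21 / 20 * t ^+ 2 * sqnorm p + 80 / 21 * sqnorm c.
  have := sqnorm_ge0 ((21 / 20 * t) *: p - 2 *: c).
  by rewrite /sqnorm !innerE (innerC p c); lra.
have Hzg : sqnorm (zg - p) <= 5 / 4 * sqnorm yg + 10 * sqnorm s + 10 * sqnorm p.
  have -> : zg - p = - yg + (s - p) by rewrite sE -addrA addKr.
  have := sqnormD_le (- yg) (s - p) (_ : 0 < 4^-1) => /(_ ltac:(lra)).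
  have := sqnorm_ge0 (s + p).
  by rewrite invrK /sqnorm !innerE !(innerC p s); lra.
have Hyg : sqnorm yg <= 2 * sqnorm yf' + 2 * (t / 32) ^+ 2 * sqnorm (y' - y).
  have -> : yg = yf' - (t / 32) *: (y' - y) by rewrite yf'E addrK.
  have := sqnormD_le yf' (- ((t / 32) *: (y' - y))) (_ : 0 < 1) => /(_ ltac:(lra)).
  by rewrite invr1 /sqnorm !innerE; lra.
have {}hD : t ^+ 3 / 2 * sqnorm h <= L * t ^+ 3 * Dg.
  have -> : L * t ^+ 3 * Dg = t ^+ 3 / 2 * (2 * L * Dg) by field.
  by rewrite ler_wpM2l// divr_ge0// exprn_ge0// ltW.
(* Once scaled by powers of [t], all bounds are linear in the products [t ^+ k * sqnorm X]; these
   facts give their signs and their ordering in [k] for [t <= 1]. *)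
have tn k (X : 'M[R]_(m, n)) : 0 <= t ^+ k * sqnorm X.
  by rewrite mulr_ge0 ?exprn_ge0 ?sqnorm_ge0 ?ltW.
have tnB k l (X : 'M[R]_(m, n)) : 0 <= t ^+ k * (1 - t ^+ l) * sqnorm X.
  by rewrite !mulr_ge0 ?exprn_ge0 ?sqnorm_ge0 ?subr_ge0 ?exprn_ile1// ltW.
have {}HYF := ler_wpM2l (exprn_ge0 2 (ltW t0)) HYF.
have {}Hzg := ler_wpM2l (exprn_ge0 3 (ltW t0)) Hzg.
have {}Hyg := ler_wpM2l (exprn_ge0 3 (ltW t0)) Hyg.
move: HS HY HZ HP Hcross hD HYF Hzg Hyg; rewrite !innerE.
move: (tn 3 y') (tn 3 yf') (tn 3 zh) (tn 2 p) (tnB 2 1 p) (tn 1 s) (tnB 1 2 s).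
move: (sqnorm_ge0 c) (tn 2 (y' - y)) (tnB 2 3 (y' - y)) (tn 3 y) (tnB 3 1 y).
rewrite !expr1; clear; lra.
Qed.



End Descent.

(** * The objective, its optimality condition and its Bregman divergence *)

Section Objective.
Context {R : realType} {n d : nat}.
Variables (f : 'I_n -> 'rV[R]_d -> R) (L mu : R).
Hypothesis smooth_f : forall i, smooth L (f i).
Hypothesis convex_f : forall i, strongly_convex mu (f i).
Implicit Types (X Y Z : 'M[R]_(n, d)).

Let G := grad_objective f.

Lemma objective_smooth X Y :
  objective f X <=
    objective f Y + inner (G Y) (X - Y) + L / 2 * sqnorm (X - Y).
Proof.
rewrite /sqnorm !inner_rows mulr_sumr -!big_split ler_sum// => i _ /=.
by rewrite rowK linearB; exact: smooth_f.
Qed.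

Lemma objective_strongly_convex X Y :
  objective f Y + inner (G Y) (X - Y) + mu / 2 * sqnorm (X - Y) <=
    objective f X.
Proof.
rewrite /sqnorm !inner_rows mulr_sumr -!big_split ler_sum// => i _ /=.
by rewrite rowK linearB; exact: convex_f.
Qed.

(** First-order optimality: the smoothness bound along consensus directions forces the gradient to
    be orthogonal to all of them. *)
Lemma grad_solution xs : 0 <= L -> is_solution f xs -> zero_sum (G xs).
Proof.
move=> L0 [cxs xsmin].
have orth (V : 'M[R]_(n, d)) : consensus V -> inner (G xs) V = 0.
  move=> cV; set g := inner _ _; pose q := L / 2 * sqnorm V.
  have q0 : 0 <= q by rewrite mulr_ge0 ?sqnorm_ge0 ?divr_ge0.
  (* The bound [a * g + a ^+ 2 * q] then equals [- (g / (q + 1)) ^+ 2]; the [+ 1] keeps the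
     denominator positive when [q = 0]. *)
  pose a := - g / (q + 1).
  have /xsmin : consensus (xs + a *: V).
    apply/consensusP => i k j; move/consensusP: cxs => cxs.
    by move/consensusP: cV => cV; rewrite !mxE (cxs i k) (cV i k).
  move/le_trans => /(_ _ (objective_smooth _ xs)).
  rewrite [xs + _]addrC !addrK -addrA lerDl /sqnorm !innerE -/g.
  have -> : a * g + L / 2 * (a * (a * inner V V)) = - (g / (q + 1)) ^+ 2.
    transitivity (a * g + a ^+ 2 * q); first by rewrite /q /sqnorm; ring.
    by rewrite /a; field; lra.
  rewrite oppr_ge0 => H; have /eqP : (g / (q + 1)) ^+ 2 == 0.
    by rewrite eq_le H sqr_ge0.
  move/eqP; rewrite sqrf_eq0 mulf_eq0 invr_eq0.
  by rewrite (gt_eqF (_ : 0 < q + 1)) ?orbF; [move/eqP|lra].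
apply/zero_sumP => j.
(* Testing against the consensus matrix with ones in column [j] extracts the sum of that column. *)
rewrite -[RHS](orth (\matrix_(i, k) (k == j)%:R)); last first.
  by apply/consensusP => i k l; rewrite !mxE.
apply: eq_bigr => i _; rewrite (bigD1 j)//= big1 => [|k /negPf kj].
  by rewrite addr0 mxE eqxx mulr1.
by rewrite mxE kj mulr0.
Qed.

(* Bregman divergence of [F - nu / 2 * |.|^2]. *)
Definition bregman (nu : R) xs X : R :=
  objective f X - objective f xs - inner (G xs) (X - xs) - nu / 2 * sqnorm (X - xs).

Definition grad_bregman (nu : R) xs X : 'M[R]_(n, d) :=
  G X - G xs - nu *: (X - xs).

Lemma bregman_smooth nu xs X Y :
  bregman nu xs X <= bregman nu xs Y + inner (grad_bregman nu xs Y) (X - Y)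
    + (L - nu) / 2 * sqnorm (X - Y).
Proof.
have := objective_smooth X Y.
rewrite /bregman /grad_bregman /sqnorm !innerE.
rewrite !(innerC xs) !(innerC Y X); lra.
Qed.

Lemma bregman_strongly_convex nu xs X Y :
  bregman nu xs Y + inner (grad_bregman nu xs Y) (X - Y)
    + (mu - nu) / 2 * sqnorm (X - Y) <= bregman nu xs X.
Proof.
have := objective_strongly_convex X Y.
rewrite /bregman /grad_bregman /sqnorm !innerE.
rewrite !(innerC xs) !(innerC Y X); lra.
Qed.

Lemma bregman_id nu xs : bregman nu xs xs = 0.
Proof. by rewrite /bregman /sqnorm !subrr innerC !inner0l mulr0 !subr0. Qed.

Lemma grad_bregman_id nu xs : grad_bregman nu xs xs = 0.
Proof. by rewrite /grad_bregman !subrr scaler0 subr0. Qed.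

Lemma bregman_ge0 nu xs X : nu <= mu -> 0 <= bregman nu xs X.
Proof.
move=> numu; apply: le_trans (bregman_strongly_convex nu xs X xs).
rewrite bregman_id grad_bregman_id inner0l !add0r.
by rewrite mulr_ge0 ?sqnorm_ge0// divr_ge0// subr_ge0.
Qed.

(** A gradient step of length [1 / L] from [X] cannot bring the divergence below 0. *)
Lemma bregman_cocoercive nu xs X : 0 < L -> 0 <= nu <= mu ->
  sqnorm (grad_bregman nu xs X) <= 2 * L * bregman nu xs X.
Proof.
move=> L0 /andP[nu0 numu]; set h := grad_bregman nu xs X.
have := le_trans (bregman_ge0 xs (X - L^-1 *: h) numu) (bregman_smooth _ _ _ X).
rewrite -/h; move: h => h.
have -> : X - L^-1 *: h - X = - (L^-1 *: h) by rewrite addrAC subrr add0r.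
rewrite /sqnorm !innerE => H.
have : 0 <= 2 * L * (bregman nu xs X - L^-1 * inner h h
   + (L - nu) / 2 * (L^-1 * (L^-1 * inner h h))) by rewrite mulr_ge0//; lra.
have -> : 2 * L * (bregman nu xs X - L^-1 * inner h h
   + (L - nu) / 2 * (L^-1 * (L^-1 * inner h h))) =
  2 * L * bregman nu xs X - inner h h - nu / L * inner h h by field; lra.
have : 0 <= nu / L * inner h h.
  by rewrite mulr_ge0 ?divr_ge0 ?(ltW L0)//; exact: sqnorm_ge0.
by lra.
Qed.

End Objective.

(** Writing [mu = L * t ^+ 2] removes the square roots: all coefficients become rational in [L] and
    [t]. *)
Lemma adom_coefficientsE (R : realType) (L t : R) : 0 < L -> 0 < t ->
  adom_coefficients 2 L (L * t ^+ 2) =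
  {| tau1 := 2 * t / (2 + t); tau2 := t; Defs.eta := (L * t)^-1;
     alpha := L * t ^+ 2 / 2; nu := L * t ^+ 2 / 2; beta := (2 * L)^-1;
     sigma1 := 2 * t / (64 + t); sigma2 := t / 32; theta := 4 * L * t;
     gamma := 2 / 7 * L * t; delta := (17 * L)^-1; zeta := 2^-1 |}.
Proof.
move=> L0 t0; rewrite /adom_coefficients.
have -> : L * t ^+ 2 / L = t ^+ 2 by field; lra.
rewrite sqrtr_sqr gtr0_norm// sqrtrM ?(ltW L0)// sqrtr_sqr gtr0_norm//.
have sL : 0 < Num.sqrt L by rewrite sqrtr_gt0.
have -> : Num.sqrt L * t / (16 * 2 * Num.sqrt L) = t / 32 by field; lra.
by congr Coefficients; field; lra.
Qed.

Lemma affine_comb_subr (R : realType) (m n : nat) (a : R) (X Y V : 'M[R]_(m, n)) :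
  a *: X + (1 - a) *: Y - V = a *: (X - V) + (1 - a) *: (Y - V).
Proof. by apply/matrixP => i j; rewrite !mxE; ring. Qed.

(** * The Lyapunov function and its decay *)

Section Lyapunov.
Context {R : realType} {n d : nat}.
Variables (f : 'I_n -> 'rV[R]_d -> R) (L t : R) (xs : 'M[R]_(n, d)).
Hypotheses (L0 : 0 < L) (t0 : 0 < t) (t1 : t <= 1).
Hypothesis smooth_f : forall i, smooth L (f i).
Hypothesis convex_f : forall i, strongly_convex (L * t ^+ 2) (f i).
Hypothesis xs_solution : is_solution f xs.

Let G := grad_objective f.
Let nu := L * t ^+ 2 / 2.

(** The primal part carries the factor [L * t ^+ 3] so that its coupling term cancels that of the
    dual part. *)
Definition lyapunov (s : state R n d) : R :=
  let ys := G xs - nu *: xs in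
  let zs := - G xs in
  L * t ^+ 3 * (L * (t + t ^+ 2 / 2) * sqnorm (sx s - xs)
                + 2 / t * bregman f nu xs (sxf s))
  + ((t ^+ 2 / 4 + t ^+ 3 / 32) * sqnorm (sy s - ys)
     + 64 / 5 * t ^+ 2 * sqnorm (syf s - ys)
     + 7 / 2 * t ^+ 2 * sqnorm (sz s - zs - centering (sm s))
     + 14 * t ^+ 2 * sqnorm (centering (sm s))
     + 64 * sqnorm (syf s + szf s - (ys + zs))).

Lemma lyapunov_step (W : 'M[R]_n) (T : nat) (s s' : state R n d) :
  averaging 2^-1 W -> zero_sum (sz s) ->
  adom_step (adom_coefficients 2 L (L * t ^+ 2)) G T W s s' ->
  lyapunov s' <= (1 - t / 64) * lyapunov s.
Proof.
move=> avW z0; rewrite /adom_step adom_coefficientsE//= -/nu.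
set xg := _ *: sx s + _; set yg := _ *: sy s + _; set zg := _ *: sz s + _.
set u := _ + sm s.
move=> [xE [xfE [yE [yfE [zE [mE [zfE _]]]]]]].
pose ys := G xs - nu *: xs; pose zs := - G xs.
have Gxs0 : zero_sum (G xs) by exact: grad_solution (ltW L0) xs_solution.
have cxs : consensus xs by case: xs_solution.
(* Since [ys + zs = - nu *: xs] is a consensus matrix, [W] and [centering] act alike on [S] and on
   [yg + zg]. *)
pose S := (yg - ys) + (zg - zs).
have SE : yg + zg = S - nu *: xs.
  by apply/matrixP => i j; rewrite /S /ys /zs; move: (G xs) => g; rewrite !mxE; ring.
have cnu : consensus (nu *: xs).
  by apply/consensusP => i k j; move/consensusP: cxs => c; rewrite !mxE (c i k).
have WS : W *m (yg + zg) = W *m S.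
  by rewrite SE mulmxBr (averaging_kernel avW cnu) subr0.
have cS : centering (yg + zg) = centering S.
  by rewrite SE centeringD -scaleN1r centeringZ (centering_consensus cnu) scaler0 addr0.
have WC X : W *m X = W *m centering X.
  rewrite -[in LHS](subrK (centering X) X) mulmxDr.
  by rewrite (averaging_kernel avW (consensus_subr_centering X)) add0r.
have cu : centering u = (2 / 7 * L * t * nu^-1) *: centering S + centering (sm s).
  by rewrite /u centeringD centeringZ cS.
have cm : centering (sm s') = centering u - W *m centering u.
  rewrite mE centeringD -scaleN1r centeringZ (centering_id (averaging_range avW u)).
  by rewrite scaleN1r -WC.
have p'u : sqnorm (centering (sm s')) <= 2^-1 * sqnorm (centering u).
  by rewrite cm; apply: (averaging_contraction avW) => //; exact: zero_sum_centering.
have numu : 0 <= nu <= L * t ^+ 2.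
  by rewrite /nu; have : 0 < L * t ^+ 2; [rewrite mulr_gt0 ?exprn_gt0|lra].
have Hx : L * (t + t ^+ 2 / 2) * sqnorm (sx s' - xs)
     + 2 / t * bregman f nu xs (sxf s') + bregman f nu xs xg <=
    L * t * sqnorm (sx s - xs) + (2 / t - 1) * bregman f nu xs (sxf s)
     + 2 * inner (sx s' - xs) (sy s' - ys).
  apply: (@primal_descent _ _ _ L t _ (sxf s - xs) (xg - xs) _ (sxf s' - xs)
    (grad_bregman f nu xs xg)) => //.
  - exact: affine_comb_subr.
  - rewrite {1}xE /grad_bregman /ys -/G -/nu; move: (G xs) (G xg) => g g'.
    by apply/matrixP => i j; rewrite !mxE; ring.
  - by rewrite xfE; apply/matrixP => i j; rewrite !mxE; ring.
  - apply: le_trans (bregman_smooth smooth_f nu xs _ xg) _.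
    rewrite !opprB !addrA !subrK lerD2l ler_wpM2r ?sqnorm_ge0//.
    by case/andP: numu; lra.
  - apply: le_trans (bregman_strongly_convex convex_f nu xs _ xg).
    rewrite !opprB !addrA !subrK lerDl mulr_ge0 ?sqnorm_ge0//.
    by case/andP: numu; lra.
  - have := bregman_strongly_convex convex_f nu xs xs xg.
    rewrite bregman_id -[xs - xg]opprB /sqnorm !innerNl !innerNr opprK.
    by apply: le_trans; rewrite lerD2l /nu; lra.
have Hy := @dual_descent _ _ _ L t (bregman f nu xs xg) (sx s' - xs) (sy s - ys)
  (sy s' - ys) (syf s - ys) (yg - ys) (syf s' - ys) (grad_bregman f nu xs xg)
  (sz s - zs) (szf s - zs) (zg - zs) (sz s - zs - centering (sm s))
  (sz s' - zs - centering (sm s')) (centering (sm s)) (centering (sm s'))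
  S (syf s + szf s - (ys + zs)) (syf s' + szf s' - (ys + zs)) (W *m S) (centering S).
have {}Hy := Hy L0 t0 t1.
have {}Hy := Hy (affine_comb_subr _ _ _ _).
(* Without its primal part, the Lyapunov function is exactly the quadratic form of
   [dual_descent]. *)
have {}Hy : lyapunov s' - L * t ^+ 3 * (L * (t + t ^+ 2 / 2) * sqnorm (sx s' - xs)
                + 2 / t * bregman f nu xs (sxf s')) <= (1 - t / 64) *
  (lyapunov s - L * t ^+ 3 * (L * (t + t ^+ 2 / 2) * sqnorm (sx s - xs)
                + 2 / t * bregman f nu xs (sxf s)))
  + L * t ^+ 3 * bregman f nu xs xg -
       2 * L * t ^+ 3 * inner (sx s' - xs) (sy s' - ys).
  rewrite /lyapunov -/ys -/zs ![L * t ^+ 3 * _ + _]addrC !addrK; apply: Hy.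
  - rewrite {1}yE /S /grad_bregman /zs /ys -/G -/nu.
    move: (G xs) (G xg) => g g'; clearbody yg zg xg.
    by apply/matrixP => i j; rewrite !mxE /nu; field; rewrite !gt_eqF.
  - by rewrite yfE; clearbody ys yg; apply/matrixP => i j; rewrite !mxE; ring.
  - exact: affine_comb_subr.
  - by rewrite subrK.
  (* The same [W *m centering u] occurs in the updates of [z] and of the centered memory, so it
     drops out of their difference. *)
  - rewrite zE cm (WC _ u); move: (W *m centering u) => a.
    rewrite cu -/nu; move: (centering S) (centering (sm s)) => b c.
    clearbody zg zs nu.
    by apply/matrixP => i j; rewrite !mxE; ring.
  - by [].
  - by rewrite opprD addrACA.
  - by rewrite zfE WS opprD addrACA [X in _ + X]addrAC.
  - rewrite innerC inner_centering 1?innerC//.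
    by apply: zero_sumD => //; rewrite /zs opprK.
  - rewrite innerC inner_centering 1?innerC//; exact: (averaging_range avW).
  - rewrite WC; apply: (averaging_contraction avW) => //; exact: zero_sum_centering.
  - by rewrite -cu.
  - exact: (bregman_cocoercive smooth_f convex_f).
have c0 : 0 <= 1 / 2 - (1 + t / 2) / 64 by move: t1; lra.
have X0 := sqnorm_ge0 (sx s - xs).
have D0 : 0 <= bregman f nu xs (sxf s).
  by apply: (bregman_ge0 convex_f); case/andP: numu.
rewrite -subr_ge0 in Hx.
have {}Hx : 0 <= L * t ^+ 3 * _ := mulr_ge0 (mulr_ge0 (ltW L0) (exprn_ge0 3 (ltW t0))) Hx.
rewrite -subr_ge0; rewrite -subr_ge0 in Hy.
set b := (X in 0 <= X).
set b1 := (X in 0 <= X) in Hx; set b2 := (X in 0 <= X) in Hy.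
(* The last two terms are the slack by which the primal bound beats the rate [1 - t / 64]. *)
have -> : b = b1 + b2 + L ^+ 2 * t ^+ 5 * sqnorm (sx s - xs) * (1 / 2 - (1 + t / 2) / 64)
    + L * t ^+ 3 * bregman f nu xs (sxf s) * (31 / 32).
  by rewrite /b /b1 /b2; field; rewrite ?gt_eqF.
clearbody b1 b2.
by rewrite !addr_ge0 ?mulr_ge0 ?exprn_ge0 ?(ltW L0) ?(ltW t0).
Qed.

(** Every other term is nonnegative, the divergence because [nu <= mu]. *)
Lemma lyapunov_ge (s : state R n d) :
  L ^+ 2 * t ^+ 4 * sqnorm (sx s - xs) <= lyapunov s.
Proof.
have numu : nu <= L * t ^+ 2.
  by rewrite /nu; have : 0 < L * t ^+ 2; [rewrite mulr_gt0 ?exprn_gt0|lra].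
have D0 := bregman_ge0 convex_f xs (sxf s) numu.
have tn k : 0 <= t ^+ k by rewrite exprn_ge0 ?ltW.
rewrite -subr_ge0 /lyapunov; set dual := (X in _ + X - _).
have dual0 : 0 <= dual.
  have c1 : 0 <= t ^+ 2 / 4 + t ^+ 3 / 32.
    by have := tn 2%N; have := tn 3%N; lra.
  by rewrite !addr_ge0 ?mulr_ge0 ?sqnorm_ge0 ?(ltW t0).
clearbody dual; set b := (X in 0 <= X).
have -> : b = dual + L ^+ 2 * t ^+ 5 / 2 * sqnorm (sx s - xs)
    + L * t ^+ 2 * (2 * bregman f nu xs (sxf s)).
  by rewrite /b; field; rewrite ?gt_eqF.
by rewrite !addr_ge0 ?mulr_ge0 ?sqnorm_ge0 ?invr_ge0 ?exprn_ge0 ?(ltW L0) ?(ltW t0).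
Qed.

End Lyapunov.

(** * Linear convergence along a run *)

Section Convergence.
Context {R : realType} {n d : nat}.
Variables (f : 'I_n -> 'rV[R]_d -> R) (L t chi : R) (xs : 'M[R]_(n, d)).
Variables (E : nat -> rel 'I_n) (W : nat -> 'M[R]_n).
Variables (x0 y0 z0 m0 : 'M[R]_(n, d)) (s : nat -> state R n d).
Hypotheses (L0 : 0 < L) (t0 : 0 < t) (t1 : t <= 1).
Hypothesis smooth_f : forall i, smooth L (f i).
Hypothesis convex_f : forall i, strongly_convex (L * t ^+ 2) (f i).
Hypothesis xs_solution : is_solution f xs.
Hypotheses (chi1 : 1 <= chi) (gW : gossip_sequence chi E W).
Hypothesis z00 : zero_sum z0.
Let T := consensus_length chi.
Hypothesis run : adom_run (adom_coefficients 2 L (L * t ^+ 2))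
  (grad_objective f) W T x0 y0 z0 m0 s.

(** [lyapunov_step] needs only [z] to be zero-sum; [zf] is carried along because [zg] mixes both. *)
Lemma adom_run_zero_sum k : zero_sum (sz (s k)) /\ zero_sum (szf (s k)).
Proof.
case: run => s0 step; elim: k => [|k [IHz IHzf]]; first by rewrite s0.
have avW := multi_consensus_averaging k chi1 gW.
have [_ [_ [_ [_ [-> [_ [-> _]]]]]]] := step k.
have zg0 : zero_sum (sigma1 (adom_coefficients 2 L (L * t ^+ 2)) *: sz (s k)
    + (1 - sigma1 (adom_coefficients 2 L (L * t ^+ 2))) *: szf (s k)).
  by apply: zero_sumD; exact: zero_sumZ.
by split; repeat first [apply: zero_sumD | apply: zero_sumN | apply: zero_sumZ
  | exact: (averaging_range avW) | done].
Qed.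

Lemma adom_run_rounds k :
  local_rounds (s k) = k /\ comm_rounds (s k) = (k * T)%N.
Proof.
case: run => s0 step; elim: k => [|k [IHl IHc]]; first by rewrite s0.
have [_ [_ [_ [_ [_ [_ [_ [-> ->]]]]]]]] := step k.
by rewrite IHl IHc addn1 mulSn addnC.
Qed.

Lemma lyapunov_decay k :
  lyapunov f L t xs (s k) <= expR (- (t / 64 * k%:R)) * lyapunov f L t xs (s 0%N).
Proof.
have lyap0 : 0 <= lyapunov f L t xs (s 0%N).
  apply: le_trans (lyapunov_ge xs L0 t0 convex_f _).
  by rewrite !mulr_ge0 ?exprn_ge0 ?sqnorm_ge0 ?(ltW L0) ?(ltW t0).
elim: k => [|k IH]; first by rewrite mulr0 oppr0 expR0 mul1r.
have [zk _] := adom_run_zero_sum k.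
apply: le_trans (lyapunov_step L0 t0 t1 smooth_f convex_f xs_solution
  (multi_consensus_averaging k chi1 gW) zk (proj2 run k)) _.
have t64 : 0 <= 1 - t / 64 by move: t1; lra.
apply: le_trans (ler_wpM2l t64 IH) _; rewrite mulrA ler_wpM2r//.
rewrite -[k.+1%:R]natr1 mulrDr mulr1 opprD expRD mulrC ler_wpM2l ?expR_ge0//.
exact: expR_ge1Dx.
Qed.

Lemma adom_linear_convergence k : sqnorm (sx (s k) - xs) <=
  expR (- (t / 64 * k%:R)) * (lyapunov f L t xs (s 0%N) / (L ^+ 2 * t ^+ 4)).
Proof.
have Lt : 0 < L ^+ 2 * t ^+ 4 by rewrite mulr_gt0 ?exprn_gt0.
rewrite mulrA ler_pdivlMr// mulrC.
exact: le_trans (lyapunov_ge xs L0 t0 convex_f _) (lyapunov_decay k).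
Qed.

End Convergence.

(** * From the linear rate to round counts *)

Theorem theorem6 (R : realType) :
  exists C : R, 0 < C /\
  forall (n d : nat) (mu L : R) (f : 'I_n -> 'rV[R]_d -> R)
    (chi : R) (E : nat -> rel 'I_n) (W : nat -> 'M[R]_n)
    (xs x0 y0 z0 m0 : 'M[R]_(n, d)) (s : nat -> state R n d),
  0 < mu -> mu <= L ->
  (forall i x, differentiable (f i) x) ->
  (forall i, smooth L (f i)) ->
  (forall i, strongly_convex mu (f i)) ->
  is_solution f xs ->
  1 <= chi ->
  gossip_sequence chi E W ->
  zero_sum z0 ->
  adom_run (adom_coefficients 2 L mu) (grad_objective f) W (consensus_length chi)
    x0 y0 z0 m0 s ->
  exists eps0 : R, 0 < eps0 /\
  forall eps : R, 0 < eps -> eps < eps0 ->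
  exists K : nat,
    [/\ (local_rounds (s K))%:R <= C * Num.sqrt (L / mu) * ln (eps^-1),
        (comm_rounds (s K))%:R <= C * (chi * Num.sqrt (L / mu)) * ln (eps^-1) &
        forall k : nat, (K <= k)%N -> accurate eps xs (sx (s k))].
Proof.
(* [258 = 129 * 2]: at most [129 * l / t] iterations, each of at most [2 * chi] communication
   rounds. *)
exists 258; split => // n d mu L f chi E W xs x0 y0 z0 m0 s mu0 muL _ smooth_f
  convex_f xs_sol chi1 gW z00.
have L0 : 0 < L by exact: lt_le_trans muL.
pose t := Num.sqrt (mu / L).
have t0 : 0 < t by rewrite sqrtr_gt0 divr_gt0.
have t1 : t <= 1.
  by rewrite -sqrtr1 ler_sqrt// ler_pdivrMr// mul1r.
have muE : mu = L * t ^+ 2.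
  by rewrite sqr_sqrtr ?divr_ge0 ?ltW//; field; rewrite gt_eqF.
have -> : Num.sqrt (L / mu) = t^-1 by rewrite -invf_div sqrtrV ?divr_ge0 ?ltW.
rewrite muE in convex_f *; clearbody t => run.
have conv := adom_linear_convergence L0 t0 t1 smooth_f convex_f xs_sol chi1 gW
  z00 run.
set M := lyapunov _ _ _ _ _ / _ in conv.
have M0 : 0 <= M.
  have := conv 0%N; rewrite mulr0 oppr0 expR0 mul1r.
  exact: le_trans (sqnorm_ge0 _).
(* The first bound ensures [ln (eps^-1) >= 1], which absorbs rounding; the second ensures
   [eps * M <= 1]. *)
exists (Num.min (expR (- 1)) (M + 1)^-1); split.
  by rewrite lt_min expR_gt0 invr_gt0 ltr_wpDl.
move=> eps eps0; rewrite lt_min => /andP[epse epsM].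
set l := ln _.
have l1 : 1 <= l.
  rewrite /l -[leLHS]opprK -[- (1)]expRK -lnV ?posrE ?expR_gt0//.
  by rewrite ler_ln ?posrE ?invr_gt0 ?expR_gt0// lef_pV2 ?posrE ?expR_gt0// ltW.
have epsE : eps = expR (- l) by rewrite /l lnV ?posrE// opprK lnK.
(* With [128 = 2 * 64] the decay factor falls to [eps ^+ 2]: one [eps] absorbs [M], the other is the
   target. The successor of the truncation costs one more [l / t], hence 129. *)
pose K := (Num.truncn (128 / t * l)).+1.
have tl0 : 0 <= 128 / t * l by rewrite mulr_ge0 ?divr_ge0 ?(ltW t0)//; lra.
have Kge : 128 / t * l <= K%:R by rewrite ltW// truncnS_gt.
have tl1 : 1 <= t^-1 * l by rewrite -[leLHS]mulr1 ler_pM// invf_ge1.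
have Kle : K%:R <= 129 * t^-1 * l.
  rewrite /K -natr1; have /andP[+ _] := truncn_itv tl0.
  by move: tl1; lra.
have [locK commK] := adom_run_rounds run K.
exists K; split.
- rewrite locK; apply: le_trans Kle _; move: tl1; lra.
- rewrite commK natrM.
  apply: le_trans (ler_pM _ _ Kle (consensus_length_le chi1)) _ => //.
  by rewrite le_eqVlt; apply/orP; left; apply/eqP; ring.
- move=> k Kk; apply: le_trans (conv k) _.
  have kK : 2 * l <= t / 64 * k%:R.
    apply: (@le_trans _ _ (t / 64 * K%:R)).
      have -> : 2 * l = t / 64 * (128 / t * l) by field; rewrite gt_eqF.
      by rewrite ler_wpM2l// divr_ge0// ltW.
    by rewrite ler_wpM2l ?ler_nat// divr_ge0// ltW.
  apply: (@le_trans _ _ (eps ^+ 2 * M)).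
    by rewrite ler_wpM2r// epsE -expRM_natl ler_expR; lra.
  rewrite expr2 -mulrA -[leRHS]mulr1 ler_wpM2l ?(ltW eps0)//.
  apply: le_trans (ler_wpM2r M0 (ltW epsM)) _.
  by rewrite mulrC ler_pdivrMr ?ltr_wpDl// mul1r lerDl.
Qed.
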